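(* Let $f_{4,c}(x)=x^4+c$. There are infinitely many $c\in\mathbb{Q}$ such that $f_{4,c}$ has rational periodic points of exact period $2$. Such $c$ and the corresponding $2$-periodic points $x_1,x_2$ are parametrized as follows: $c=\dfrac{t^6+4t^3-1}{4t^2}$ and $x_1,x_2=\dfrac{t^2\pm\sqrt{-t^4-2t}}{2t}$, where $t$ is a nonzero rational number such that $-t^4-2t=y^2$ for some $y\in\mathbb{Q}$.
   Context: A point $x$ is a periodic point of exact period $2$ of $f$ if $f(f(x))=x$ and $f(x)\neq x$. *)

(* Defs.v *)
From mathcomp Require Import all_boot all_order all_algebra.
From mathcomp Require Import classical_sets cardinality.

Set Implicit Arguments.
Unset Strict Implicit.
Unset Printing Implicit Defensive.

Import Order.TTheory GRing.Theory Num.Theory.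
Local Open Scope ring_scope.

Definition f4 (c x : rat) : rat := x ^+ 4 + c.

Definition exact_period2 (T : Type) (f : T -> T) (x : T) : Prop :=
  f (f x) = x /\ f x <> x.

(* Main.v *)
Require Import Defs.
From mathcomp Require Import all_boot all_order all_algebra.
From mathcomp Require Import classical_sets cardinality.
From mathcomp Require Import ring lra zify.

Set Implicit Arguments.
Unset Strict Implicit.
Unset Printing Implicit Defensive.

Import Order.TTheory GRing.Theory Num.Theory.
Local Open Scope ring_scope.

(** If x and z form a 2-cycle, subtracting x = z^4 + c from z = x^4 + c gives
(x + z)(x^2 + z^2) = -1. Hence t = x + z is nonzero and determines
(t (x - z))^2 = - t^4 - 2 t and c. Conversely each rational point of
y^2 = - t^4 - 2 t yields a 2-cycle, nondegenerate because -2 is not a cube.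
Such points have t < 0, where t |-> c is decreasing, so c determines t. The
curve is isomorphic to Y^2 = X^3 - 4 through t = -2 / X; iterating the
duplication map from t = -2/5 raises the 2-adic valuation of t by 2 at each
step, which produces infinitely many t, hence infinitely many c. *)

Definition cycle_param (R : fieldType) (t : R) : R :=
  (t ^+ 6 + 4 * t ^+ 3 - 1) / (4 * t ^+ 2).

(** The difference of the two values is [s - t] times a function of [p = s t] and [q = - (s + t)],
    both positive; the inequality [4 p <= q^2] makes that cofactor nonzero. *)
Lemma cycle_param_inj (R : realFieldType) (s t : R) :
  s < 0 -> t < 0 -> cycle_param s = cycle_param t -> s = t.
Proof.
move=> s0 t0 e; have s_neq0 : s != 0 by rewrite lt_eqF.
have t_neq0 : t != 0 by rewrite lt_eqF.
pose p := s * t; pose q := - (s + t).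
have p0 : 0 < p by rewrite /p nmulr_rgt0.
have q0 : 0 < q by rewrite /q; lra.
have qp : 4 * p <= q ^+ 2.
  by rewrite -subr_ge0 (_ : _ - _ = (s - t) ^+ 2) ?sqr_ge0 // /p /q; ring.
have eqpos : (q * (q ^+ 2 - 2 * p) * p ^+ 2 - 4 * p ^+ 2 + q) * (s - t) = 0.
  rewrite (_ : _ * _ = - (4 * p ^+ 2) * (cycle_param s - cycle_param t)).
    by rewrite e subrr mulr0.
  by rewrite /cycle_param /p /q; field; rewrite ?s_neq0 ?t_neq0.
clearbody p q.
(* Both sides being positive, squaring reduces [4 p^2 < q (2 p^3 + 1)] to
   [4 p^3 < (2 p^3 + 1)^2]. *)
have p3 : 0 < 2 * p ^+ 3 + 1 by have := exprn_gt0 3 p0; lra.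
have lt_pq : 4 * p ^+ 2 < q * (2 * p ^+ 3 + 1).
  rewrite -(@ltr_pXn2r _ 2) ?nnegrE ?mulr_ge0 ?exprn_ge0 ?ltW //.
  rewrite [ltRHS]exprMn; apply: lt_le_trans (_ : 4 * p * (2 * p ^+ 3 + 1) ^+ 2 <= _).
    rewrite -subr_gt0 (_ : _ - _ = 4 * p * (4 * p ^+ 6 + 1)); last by ring.
    by rewrite !mulr_gt0 //; have := exprn_gt0 6 p0; lra.
  by rewrite ler_wpM2r ?sqr_ge0.
have pos : 0 < q * (q ^+ 2 - 2 * p) * p ^+ 2 - 4 * p ^+ 2 + q.
  apply: lt_le_trans (_ : q * (2 * p ^+ 3 + 1) - 4 * p ^+ 2 <= _).
    by rewrite subr_gt0.
  rewrite -subr_ge0 (_ : _ - _ = q * p ^+ 2 * (q ^+ 2 - 4 * p)); last by ring.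
  by rewrite !mulr_ge0 ?sqr_ge0 ?subr_ge0 // ltW.
by move/eqP: eqpos; rewrite mulf_eq0 (gt_eqF pos) /= subr_eq0 => /eqP.
Qed.

Lemma curve_lt0 (R : realFieldType) (t y : R) :
  t != 0 -> - t ^+ 4 - 2 * t = y ^+ 2 -> t < 0.
Proof.
move=> t0 ey; rewrite lt_neqAle t0 leNgt /=; apply/negP => tp.
have := sqr_ge0 y; rewrite -ey; have : 0 < t ^+ 4 by rewrite exprn_gt0.
lra.
Qed.

(** Cross-multiplying [a / b] with the reduced form of [t] and taking valuations; the additive form
    avoids truncated subtraction. *)
Lemma logn_absz_eq (t : rat) (a b : int) (p : nat) :
  a != 0 -> b != 0 -> t * b%:~R = a%:~R ->
  (logn p `|numq t| + logn p `|b|)%N = (logn p `|a| + logn p `|denq t|)%N.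
Proof.
move=> a0 b0 e; have e' : numq t * b = a * denq t.
  apply: (@intr_inj rat); rewrite !rmorphM /= -e numqE; ring.
have n0 : numq t != 0.
  by apply/eqP => n0; move/eqP: e'; rewrite n0 mul0r eq_sym mulf_eq0 (negbTE a0) denq_eq0.
by rewrite -!lognM ?absz_gt0 ?denq_neq0 // -!abszM e'.
Qed.

(** The 2-adic valuations of [numq t ^+ 3] and [- 2 * denq t ^+ 3] differ modulo 3. *)
Lemma expr3_neq_opp2 (t : rat) : t ^+ 3 != - 2.
Proof.
apply/eqP => e; have n0 : numq t != 0.
  by apply/eqP => /eqP; rewrite numq_eq0 => /eqP t0; move: e; rewrite t0 expr0n.
have e' : numq t ^+ 3 = - 2 * denq t ^+ 3.
  by apply: (@intr_inj rat); rewrite rmorphXn [in RHS]rmorphM rmorphXn /= numqE exprMn e.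
have : logn 2 `|numq t ^+ 3| = logn 2 `|- 2 * denq t ^+ 3| by rewrite e'.
rewrite abszX [in RHS]abszM abszX lognM ?expn_gt0 ?absz_gt0 ?denq_neq0 // !lognX.
rewrite (_ : logn 2 `|- 2 : int| = 1%N) //; lia.
Qed.

Lemma curve_neq0 (t y : rat) : t != 0 -> - t ^+ 4 - 2 * t = y ^+ 2 -> y != 0.
Proof.
move=> t0 ey; apply/eqP => y0; move/eqP: ey.
rewrite y0 expr0n (_ : _ - _ = - t * (t ^+ 3 - - 2)); last by ring.
by rewrite mulf_eq0 oppr_eq0 (negbTE t0) subr_eq0 (negbTE (expr3_neq_opp2 t)).
Qed.

Lemma f4_curve (t y : rat) : t != 0 -> - t ^+ 4 - 2 * t = y ^+ 2 ->
  f4 (cycle_param t) ((t ^+ 2 + y) / (2 * t)) = (t ^+ 2 - y) / (2 * t).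
Proof.
move=> t0 ey; apply/eqP; rewrite -subr_eq0; apply/eqP.
(* The second factor is the quotient, over [16 t^4], of polynomial division in [y] by the curve
   equation. *)
transitivity ((y ^+ 2 - (- t ^+ 4 - 2 * t)) *
  (y ^+ 2 + 4 * t ^+ 2 * y + 5 * t ^+ 4 - 2 * t) / (16 * t ^+ 4)).
  by rewrite /f4 /cycle_param; field.
by rewrite ey subrr !mul0r.
Qed.

Lemma period2_curve (t y : rat) : t != 0 -> - t ^+ 4 - 2 * t = y ^+ 2 ->
  exact_period2 (f4 (cycle_param t)) ((t ^+ 2 + y) / (2 * t)).
Proof.
move=> t0 ey; split; rewrite f4_curve //.
  (* The image is the point attached to [- y], so a second application restores [y]. *)
  have := @f4_curve t (- y) t0; rewrite sqrrN opprK; exact.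
move/eqP; rewrite -subr_eq0 (_ : _ - _ = - y / t); last by field.
by rewrite mulf_eq0 invr_eq0 (negbTE t0) oppr_eq0 (negbTE (curve_neq0 t0 ey)).
Qed.

Lemma curve_period2 (c x : rat) (t := x + f4 c x) :
  exact_period2 (f4 c) x ->
  [/\ t != 0, - t ^+ 4 - 2 * t = (t * (x - f4 c x)) ^+ 2 & c = cycle_param t].
Proof.
rewrite /t {t} => -[]; set z := f4 c x => exz zx.
have ez : z = x ^+ 4 + c by [].
have e : (x + z) * (x ^+ 2 + z ^+ 2) = - 1.
  have d0 : x - z != 0 by rewrite subr_eq0; apply/eqP => h; apply: zx.
  apply: (mulfI d0); transitivity (x ^+ 4 - z ^+ 4); first by ring.
  by move: exz; rewrite /f4; lra.
have ec : c = (x + z - (x ^+ 4 + z ^+ 4)) / 2 by move: exz; rewrite /f4; lra.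
have t0 : x + z != 0.
  by apply/eqP => h; move: e; rewrite h mul0r => /eqP; rewrite eq_sym oppr_eq0 oner_eq0.
have es : x ^+ 2 + z ^+ 2 = - (x + z)^-1.
  by apply: (mulfI t0); rewrite e mulrN divff.
split=> //.
  transitivity ((x + z) ^+ 2 * (2 * (x ^+ 2 + z ^+ 2) - (x + z) ^+ 2)); last by ring.
  by rewrite es; field.
(* With [S = x^2 + z^2], the identity [2 x z = (x + z)^2 - S] expresses [x^4 + z^4], hence [c],
   through [x + z] and [S = - 1 / (x + z)]. *)
have -> : c = (x + z - ((x ^+ 2 + z ^+ 2) ^+ 2 -
    ((x + z) ^+ 2 - (x ^+ 2 + z ^+ 2)) ^+ 2 / 2)) / 2.
  by rewrite ec; field.
by rewrite es /cycle_param; field.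
Qed.

(** Doubling [X |-> X (X^3 + 32) / (4 (X^3 - 4))] on [Y^2 = X^3 - 4], read through [t = -2 / X]. *)
Definition duplication (R : fieldType) (t : R) : R :=
  2 * t * (2 + t ^+ 3) / (1 - 4 * t ^+ 3).

(** The square root on the right is, up to sign, the [y]-coordinate of the doubled point. *)
Lemma duplication_curve (R : fieldType) (t y : R) :
  1 - 4 * t ^+ 3 != 0 -> - t ^+ 4 - 2 * t = y ^+ 2 ->
  - duplication t ^+ 4 - 2 * duplication t =
  (2 * y * (2 * t ^+ 6 - 10 * t ^+ 3 - 1) / (1 - 4 * t ^+ 3) ^+ 2) ^+ 2.
Proof.
move=> d0 ey; rewrite !exprMn -ey /duplication; by field.
Qed.

(* The 2-adic valuation of [t] is [n]. *)
Definition val2 (n : nat) (t : rat) : Prop :=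
  exists a b : int, [/\ odd `|a|, odd `|b| & t * b%:~R = (2 ^+ n * a)%:~R].

Lemma odd_neq0 (a : int) : odd `|a| -> a != 0.
Proof. by case: eqP => // ->. Qed.

Lemma val2_neq0 n t : val2 n t -> t != 0.
Proof.
move=> [a [b [/odd_neq0 a0 _ e]]]; apply/eqP => t0; move/eqP: e.
by rewrite t0 mul0r eq_sym intr_eq0 mulf_eq0 (negbTE a0) expf_eq0 andbF.
Qed.

Lemma val2_logn n t : val2 n t -> logn 2 `|numq t| = (n + logn 2 `|denq t|)%N.
Proof.
move=> [a [b [oa ob e]]].
have l0 (c : int) : odd `|c| -> logn 2 `|c| = 0%N.
  by move=> oc; apply/eqP; rewrite -leqn0 leqNgt logn_gt0 mem_primes dvdn2 oc !andbF.
have a0 : 2 ^+ n * a != 0 by rewrite mulf_neq0 ?expf_neq0 // odd_neq0.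
have := logn_absz_eq 2 a0 (odd_neq0 ob) e.
by rewrite abszM abszX lognM ?expn_gt0 // ?absz_gt0 ?odd_neq0 // lognX (l0 _ oa) (l0 _ ob) !addn0 muln1.
Qed.

Lemma val2_inj m n t : val2 m t -> val2 n t -> m = n.
Proof. by move=> /val2_logn em /val2_logn; rewrite em => /addIn. Qed.

Lemma val2_denom n t : val2 n.+1 t -> 1 - 4 * t ^+ 3 != 0.
Proof.
move=> [a [b [oa ob e]]]; apply/eqP => h.
have : b ^+ 3 - 4 * (2 ^+ n.+1 * a) ^+ 3 = 0.
  apply: (@intr_inj rat); rewrite !(rmorphB, rmorphM, rmorphXn) /=.
  transitivity ((1 - 4 * t ^+ 3) * b%:~R ^+ 3); last by rewrite h mul0r.
  have -> : (2%:~R ^+ n.+1 * a%:~R : rat) = t * b%:~R by rewrite e rmorphM rmorphXn.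
  by ring.
(* Parity contradiction: [b ^+ 3] is odd, while the other side is a multiple of 4. *)
move/eqP; rewrite subr_eq0 => /eqP /(congr1 (odd \o absz)) /=.
by rewrite abszX oddX ob abszM oddM.
Qed.

Lemma odd_absz_addl_double (u v : int) : odd `|u + 2 * v| = odd `|u|.
Proof. lia. Qed.

Lemma val2_duplication n t : val2 n.+1 t -> val2 n.+3 (duplication t).
Proof.
move=> h; have d0 := val2_denom h; case: h => a [b [oa ob e]].
pose c : int := 2 ^+ n * a.
have ec : t * b%:~R = 2 * c%:~R by rewrite e exprS -mulrA rmorphM.
(* For [t = 2 c / b] the duplicate is [8 c (b^3 + 4 c^3) / (b (b^3 - 32 c^3))]; both parenthesised
   cubic sums are odd and [8 c = 2^(n+3) a]. *)
exists (a * (b ^+ 3 + 2 * (2 * c ^+ 3))), (b * (b ^+ 3 + 2 * (- 16 * c ^+ 3))).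
split.
- by rewrite abszM oddM oa odd_absz_addl_double abszX oddX ob.
- by rewrite abszM oddM ob odd_absz_addl_double abszX oddX ob.
have b0 : (b%:~R : rat) != 0 by rewrite intr_eq0 odd_neq0.
have -> : 2 ^+ n.+3 * (a * (b ^+ 3 + 2 * (2 * c ^+ 3))) =
    8 * c * (b ^+ 3 + 2 * (2 * c ^+ 3)) by rewrite /c !exprS; ring.
clearbody c; rewrite !(rmorphXn, rmorphD, rmorphM) /=.
have -> : (c%:~R : rat) = t * b%:~R / 2 by rewrite ec; field.
by rewrite /duplication; field.
Qed.

(** The start is the point [(5, 11)] of [Y^2 = X^3 - 4], the double of [(2, 2)]; the latter gives
    [t = -1], whose valuation is not yet positive. *)
Definition curve_seq (n : nat) : rat := iter n (@duplication rat) (- 2 / 5).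

Lemma val2_curve_seq n : val2 n.*2.+1 (curve_seq n).
Proof.
elim: n => [|n IH]; last exact: val2_duplication.
by exists (- 1), 5; split.
Qed.

Lemma curve_seq_curve n :
  exists y, - curve_seq n ^+ 4 - 2 * curve_seq n = y ^+ 2.
Proof.
elim: n => [|n [y ey]]; first by exists (22 / 25).
by eexists; apply: (duplication_curve (val2_denom (val2_curve_seq n)) ey).
Qed.

Lemma cycle_param_curve_seq_inj : injective (fun n => cycle_param (curve_seq n)).
Proof.
have neg n : curve_seq n < 0.
  by have [y] := curve_seq_curve n; apply/curve_lt0/val2_neq0/val2_curve_seq.
move=> m n /(cycle_param_inj (neg m) (neg n)) e.
have := val2_curve_seq m; rewrite e => /val2_inj /(_ (val2_curve_seq n)).
by move=> [/double_inj].
Qed.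

Theorem theorem2p1 :
  infinite_set [set c : rat | exists x : rat, exact_period2 (f4 c) x]%classic
  /\ (forall c : rat,
        (exists x : rat, exact_period2 (f4 c) x) <->
        (exists t y : rat,
           [/\ t != 0, - t ^+ 4 - 2 * t = y ^+ 2
             & c = (t ^+ 6 + 4 * t ^+ 3 - 1) / (4 * t ^+ 2)]))
  /\ (forall t y : rat, t != 0 -> - t ^+ 4 - 2 * t = y ^+ 2 ->
        forall x : rat,
          exact_period2 (f4 ((t ^+ 6 + 4 * t ^+ 3 - 1) / (4 * t ^+ 2))) x <->
          (x = (t ^+ 2 + y) / (2 * t) \/ x = (t ^+ 2 - y) / (2 * t))).
Proof.
split; [|split].
- have := inj_card_eq (A := setT) (in2W cycle_param_curve_seq_inj).
  rewrite card_eq_le => /andP[_ le_range]; apply/infiniteP; apply: card_le_trans le_range _.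
  apply: subset_card_le => _ [n _ <-]; have [y ey] := curve_seq_curve n.
  by eexists; apply: (period2_curve _ ey); apply/val2_neq0/val2_curve_seq.
- move=> c; split=> [[x /curve_period2 [t0 ey ec]]|[t [y [t0 ey ->]]]].
    by exists (x + f4 c x), ((x + f4 c x) * (x - f4 c x)).
  by exists ((t ^+ 2 + y) / (2 * t)); apply: period2_curve.
move=> t y t0 ey x; split=> [per|[->|->]].
(* The sum of [x] and its image is a second parameter for the same [c], hence equals [t]; comparing
   squares leaves [y] or [- y] for [t] times their difference, which fixes [x]. *)
- have [s0 es ec] := curve_period2 per.
  have st := cycle_param_inj (curve_lt0 t0 ey) (curve_lt0 s0 es) ec.
  move: es; rewrite -st ey => /eqP; rewrite eqf_sqr.
  by case/orP=> /eqP ->; [left|right]; move: st s0; set z := f4 _ x => -> s0; field.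
- exact: period2_curve.
by apply: (@period2_curve t (- y)); rewrite ?sqrrN.
Qed.
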